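(* Over the base system $\mathsf{RCA}_0$, the following are equivalent: (1) $\mathsf{ACA}_0$ (arithmetical comprehension); (2) every e-matroid has a basis.
   Context: Work in second-order arithmetic; $M^{<\mathbb{N}}$ denotes the set of (codes for) finite subsets of $M$. An e-matroid is a pair $(M,e)$ with $M\subseteq\mathbb{N}$ and $e\colon\mathbb{N}\to M^{<\mathbb{N}}$ such that: (i) $e(n)\neq\emptyset$ for all $n$; (ii) for all $n$ and all finite $Y\subseteq M$, if $e(n)\subseteq Y$ then $Y=e(m)$ for some $m$; (iii) for all finite $X,Y\subseteq M$, if $|X|<|Y|$ and neither $X$ nor $Y$ is in the range of $e$, then there is $y\in Y$ such that $X\cup\{y\}$ is not in the range of $e$. The finite sets in the range of $e$ are called dependent. A set $B\subseteq M$ is independent if $e(n)\not\subseteq B$ for all $n$; $B$ spans $M$ if for every $x\in M\setminus B$ there is $n$ with $e(n)\subseteq B\cup\{x\}$; $B$ is a basis if it is independent and spans $M$. *)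

(* Defs.v *)
(** A structure for the two-sorted language L2 of second-order arithmetic, with
    arbitrary (possibly nonstandard) first-order part and an arbitrary (Henkin)
    second-order part.  As usual in first-order logic both sorts are nonempty;
    without [set_inhabited] there might be no valuation of the set variables and
    the axiom schemes below could hold vacuously.  Equality of numbers is interpreted
    by Rocq equality; L2 has no primitive equality between sets. *)
Record L2_structure : Type := {
  num : Type;
  set : Type;
  zero : num;
  one : num;
  add : num -> num -> num;
  mul : num -> num -> num;
  lt : num -> num -> Prop;
  mem : num -> set -> Prop;
  set_inhabited : inhabited set
}.

Arguments zero {_}.
Arguments one {_}.
Arguments add {_} _ _.
Arguments mul {_} _ _.
Arguments lt {_} _ _.
Arguments mem {_} _ _.

Declare Scope L2_scope.
Delimit Scope L2_scope with L2.
Bind Scope L2_scope with num.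
Notation "0" := zero : L2_scope.
Notation "1" := one : L2_scope.
Notation "x + y" := (add x y) : L2_scope.
Notation "x * y" := (mul x y) : L2_scope.
Notation "x < y" := (lt x y) : L2_scope.
Notation "x ∈ X" := (mem x X) (at level 70) : L2_scope.
Notation "x ∉ X" := (~ mem x X) (at level 70) : L2_scope.

(** ** Formulas of L2

    Number variables and set variables are two independent families of de
    Bruijn indices: [fall]/[fex] bind number variable 0 and [fallS]/[fexS] bind
    set variable 0. *)

Inductive term : Type :=
| tvar (i : nat)
| tzero
| tone
| tadd (s t : term)
| tmul (s t : term).

Inductive formula : Type :=
| feq (s t : term)
| flt (s t : term)
| fmem (t : term) (X : nat)
| fnot (p : formula)
| fand (p q : formula)
| for_ (p q : formula)
| fimp (p q : formula)
| fiff (p q : formula)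
| fall (p : formula)
| fex (p : formula)
| fallS (p : formula)
| fexS (p : formula).

Fixpoint tshift (t : term) : term :=
  match t with
  | tvar i => tvar (S i)
  | tzero => tzero
  | tone => tone
  | tadd s t => tadd (tshift s) (tshift t)
  | tmul s t => tmul (tshift s) (tshift t)
  end.

Definition scons {A : Type} (a : A) (v : nat -> A) : nat -> A :=
  fun i => match i with O => a | S j => v j end.

Fixpoint eval {A : L2_structure} (v : nat -> num A) (t : term) : num A :=
  match t with
  | tvar i => v i
  | tzero => zero
  | tone => one
  | tadd s t => add (eval v s) (eval v t)
  | tmul s t => mul (eval v s) (eval v t)
  end.

Fixpoint sat {A : L2_structure} (v : nat -> num A) (V : nat -> set A)
    (p : formula) : Prop :=
  match p with
  | feq s t => eval v s = eval v t
  | flt s t => lt (eval v s) (eval v t)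
  | fmem t X => mem (eval v t) (V X)
  | fnot p => ~ sat v V p
  | fand p q => sat v V p /\ sat v V q
  | for_ p q => sat v V p \/ sat v V q
  | fimp p q => sat v V p -> sat v V q
  | fiff p q => sat v V p <-> sat v V q
  | fall p => forall n : num A, sat (scons n v) V p
  | fex p => exists n : num A, sat (scons n v) V p
  | fallS p => forall X : set A, sat v (scons X V) p
  | fexS p => exists X : set A, sat v (scons X V) p
  end.

(** In a bounded quantifier the bounding term must not contain the bound
    variable; this is what [tshift] enforces. *)
Inductive bounded : formula -> Prop :=
| bd_eq s t : bounded (feq s t)
| bd_lt s t : bounded (flt s t)
| bd_mem t X : bounded (fmem t X)
| bd_not p : bounded p -> bounded (fnot p)
| bd_and p q : bounded p -> bounded q -> bounded (fand p q)
| bd_or p q : bounded p -> bounded q -> bounded (for_ p q)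
| bd_imp p q : bounded p -> bounded q -> bounded (fimp p q)
| bd_iff p q : bounded p -> bounded q -> bounded (fiff p q)
| bd_all t p :
    bounded p -> bounded (fall (fimp (flt (tvar 0) (tshift t)) p))
| bd_ex t p :
    bounded p -> bounded (fex (fand (flt (tvar 0) (tshift t)) p)).

Definition Sigma01 (p : formula) : Prop := exists q, bounded q /\ p = fex q.

Definition Pi01 (p : formula) : Prop := exists q, bounded q /\ p = fall q.

(** Free set variables (set parameters) are allowed. *)
Fixpoint arithmetical (p : formula) : Prop :=
  match p with
  | feq _ _ | flt _ _ | fmem _ _ => True
  | fnot p | fall p | fex p => arithmetical p
  | fand p q | for_ p q | fimp p q | fiff p q =>
      arithmetical p /\ arithmetical q
  | fallS _ | fexS _ => False
  end.

(** ** The subsystems RCA_0 and ACA_0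

    The schemes are closed universally by quantifying over all valuations.  In
    the comprehension schemes the set [X] is not in the range of [V], so it is
    not a free variable of the defining formula. *)

Open Scope L2_scope.

Record basic_axioms (A : L2_structure) : Prop := {
  ax_succ_neq0 : forall n : num A, n + 1 <> 0;
  ax_succ_inj : forall m n : num A, m + 1 = n + 1 -> m = n;
  ax_add0 : forall m : num A, m + 0 = m;
  ax_addS : forall m n : num A, m + (n + 1) = (m + n) + 1;
  ax_mul0 : forall m : num A, m * 0 = 0;
  ax_mulS : forall m n : num A, m * (n + 1) = m * n + m;
  ax_lt0 : forall m : num A, ~ m < 0;
  ax_ltS : forall m n : num A, m < n + 1 <-> m < n \/ m = n
}.

Definition induction_axiom (A : L2_structure) : Prop :=
  forall X : set A,
    0 ∈ X -> (forall n, n ∈ X -> n + 1 ∈ X) -> forall n, n ∈ X.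

Definition Sigma01_induction (A : L2_structure) : Prop :=
  forall p, Sigma01 p ->
  forall (v : nat -> num A) (V : nat -> set A),
    sat (scons 0 v) V p ->
    (forall n, sat (scons n v) V p -> sat (scons (n + 1) v) V p) ->
    forall n, sat (scons n v) V p.

Definition Delta01_comprehension (A : L2_structure) : Prop :=
  forall p q, Sigma01 p -> Pi01 q ->
  forall (v : nat -> num A) (V : nat -> set A),
    (forall n, sat (scons n v) V p <-> sat (scons n v) V q) ->
    exists X : set A, forall n, n ∈ X <-> sat (scons n v) V p.

Definition arithmetical_comprehension (A : L2_structure) : Prop :=
  forall p, arithmetical p ->
  forall (v : nat -> num A) (V : nat -> set A),
    exists X : set A, forall n, n ∈ X <-> sat (scons n v) V p.

Record RCA0 (A : L2_structure) : Prop := {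
  RCA0_basic : basic_axioms A;
  RCA0_induction : Sigma01_induction A;
  RCA0_comprehension : Delta01_comprehension A
}.

Record ACA0 (A : L2_structure) : Prop := {
  ACA0_basic : basic_axioms A;
  ACA0_induction : induction_axiom A;
  ACA0_comprehension : arithmetical_comprehension A
}.

(** ** Coding of finite sets and functions inside a structure

    Everything below quantifies only over the numbers and sets of [A]. *)

Section Internal.

Context {A : L2_structure}.
Implicit Types (i k m n c f x y : num A) (M E B : set A).

Definition pair i j : num A := (i + j) * (i + j) + i.

Definition triple k m n : num A := pair k (pair m n).

Definition divides m n : Prop := exists q, n = m * q.

(** Simpson's coding: the triple [(k,(m,n))] represents the finite set of those
    [i < k] such that [m(i+1)+1] divides [n]. *)
Definition fmember i c : Prop :=
  exists k m n, c = triple k m n /\ i < k /\ divides (m * (i + 1) + 1) n.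

(** The code of a finite set is the least triple representing it. *)
Definition is_code c : Prop :=
  (exists k m n, c = triple k m n) /\
  (forall c', c' < c -> (exists k m n, c' = triple k m n) ->
     ~ (forall i, fmember i c' <-> fmember i c)).

(** [c] is an element of M^{<N}. *)
Definition fin_subset M c : Prop :=
  is_code c /\ forall x, fmember x c -> x ∈ M.

(** |c| = k: some finite set [f] of pairs is a bijection from {i | i < k}
    onto [c]. *)
Definition card_eq c k : Prop :=
  exists f, is_code f /\
    (forall p, fmember p f ->
       exists i x, p = pair i x /\ i < k /\ fmember x c) /\
    (forall i, i < k -> exists! x, fmember (pair i x) f) /\
    (forall x, fmember x c -> exists! i, fmember (pair i x) f).

Definition card_lt c d : Prop :=
  exists k l, card_eq c k /\ card_eq d l /\ k < l.

(** [E] is (the graph of) a function from N to M^{<N}. *)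
Definition is_fin_subset_enum M E : Prop :=
  (forall p, p ∈ E -> exists n c, p = pair n c /\ fin_subset M c) /\
  (forall n, exists! c, pair n c ∈ E).

(** The finite set of all [x] with [P x] is in the range of [E]. *)
Definition in_range E (P : num A -> Prop) : Prop :=
  exists n c, pair n c ∈ E /\ forall x, fmember x c <-> P x.

(** ** E-matroids *)

Record ematroid M E : Prop := {
  em_enum : is_fin_subset_enum M E;
  em_nonempty : forall n c, pair n c ∈ E -> exists x, fmember x c;
  em_upward : forall n c Y, pair n c ∈ E -> fin_subset M Y ->
    (forall x, fmember x c -> fmember x Y) ->
    in_range E (fun x => fmember x Y);
  em_exchange : forall X Y, fin_subset M X -> fin_subset M Y ->
    card_lt X Y ->
    ~ in_range E (fun x => fmember x X) ->
    ~ in_range E (fun x => fmember x Y) ->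
    exists y, fmember y Y /\ ~ in_range E (fun x => fmember x X \/ x = y)
}.

Definition independent E B : Prop :=
  forall n c, pair n c ∈ E -> ~ (forall x, fmember x c -> x ∈ B).

Definition spans M E B : Prop :=
  forall x, x ∈ M -> x ∉ B ->
    exists n c, pair n c ∈ E /\ forall y, fmember y c -> y ∈ B \/ y = x.

Definition basis M E B : Prop :=
  (forall x, x ∈ B -> x ∈ M) /\ independent E B /\ spans M E B.

End Internal.

Definition every_ematroid_has_basis (A : L2_structure) : Prop :=
  forall M E : set A, ematroid M E -> exists B : set A, basis M E B.

Close Scope L2_scope.

(* Main.v *)
(** From (2) to (1): given a nonempty Sigma^0_1 set S, take M to be all numbers and call a
    finite set dependent when it meets S.  This is an e-matroid in which the
    elements of S are loops and the others are free, so its only basis is the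
    complement of S, and hence S exists.  Arithmetical comprehension follows by
    induction on formulas.

    From (1) to (2): a basis is just a maximal independent set, so the greedy
    algorithm along the order of the numbers yields one, without the exchange axiom.
    Its finite histories are coded by pairs (m, n), where i is chosen when
    m(i+1)+1 divides n; this makes the chosen set arithmetical. *)

From Stdlib Require Import Classical Arith Ring Lia.
Require Import Defs.

(** * Renaming of variables *)

(** The axiom schemes speak only of syntactic formulas, and the numbers may be nonstandard, so each
    induction and each set existence needs a formula. [def F P] provides it semantically: closure
    lemmas replace explicit de Bruijn formulas. In the reversal, dependent sets must be listed by a
    total function whose graph is a set. Meeting S is only a Sigma^0_1 property, so a pair (y, c)
    lists c only if a witness below y confirms that c meets S; every other number lists a fixed {x0}
    with x0 in S. Exchange holds because a union of X with a point of Y meets S only if X or Y does.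
    The induction on formulas rests on quantifier elimination: with set parameters, Sigma^0_1
    comprehension turns a quantified formula into membership in a new set, so arithmetical formulas
    become bounded. As sets contain single numbers, several free variables must first be packed into
    one. Every bounded set has a code (m, n) by the device of Gödel's beta function: if m is a
    nonzero multiple of all d+1 with d < k, the numbers m(i+1)+1 for i < k are pairwise coprime, and
    n is the product of the selected ones. *)

Fixpoint trename (r : nat -> nat) (t : term) : term :=
  match t with
  | tvar i => tvar (r i)
  | tzero => tzero
  | tone => tone
  | tadd s t => tadd (trename r s) (trename r t)
  | tmul s t => tmul (trename r s) (trename r t)
  end.

Definition lift (r : nat -> nat) : nat -> nat :=
  fun i => match i with O => O | S j => S (r j) end.

Fixpoint rename (r R : nat -> nat) (p : formula) : formula :=
  match p with
  | feq s t => feq (trename r s) (trename r t)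
  | flt s t => flt (trename r s) (trename r t)
  | fmem t X => fmem (trename r t) (R X)
  | fnot p => fnot (rename r R p)
  | fand p q => fand (rename r R p) (rename r R q)
  | for_ p q => for_ (rename r R p) (rename r R q)
  | fimp p q => fimp (rename r R p) (rename r R q)
  | fiff p q => fiff (rename r R p) (rename r R q)
  | fall p => fall (rename (lift r) R p)
  | fex p => fex (rename (lift r) R p)
  | fallS p => fallS (rename r (lift R) p)
  | fexS p => fexS (rename r (lift R) p)
  end.

Lemma tshift_trename t : tshift t = trename S t.
Proof. induction t; simpl; congruence. Qed.

Lemma trename_trename r r' t :
  trename r (trename r' t) = trename (fun i => r (r' i)) t.
Proof. induction t; simpl; congruence. Qed.

(** A renamed bound must again be a shifted term, which holds because [lift r] after [S] is [S]
    after [r]. *)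
Lemma bounded_rename p : bounded p -> forall r R, bounded (rename r R p).
Proof.
  induction 1; intros r R; simpl; try (constructor; auto; fail).
  - rewrite tshift_trename, trename_trename.
    change (trename (fun i => lift r (S i)) t) with (trename (fun i => S (r i)) t).
    rewrite <- (trename_trename S r), <- tshift_trename. constructor; auto.
  - rewrite tshift_trename, trename_trename.
    change (trename (fun i => lift r (S i)) t) with (trename (fun i => S (r i)) t).
    rewrite <- (trename_trename S r), <- tshift_trename. constructor; auto.
Qed.

Lemma arithmetical_rename p :
  arithmetical p -> forall r R, arithmetical (rename r R p).
Proof. induction p; simpl; intuition. Qed.

Lemma eval_rename {A : L2_structure} r t (v u : nat -> num A) :
  (forall i, u i = v (r i)) -> eval v (trename r t) = eval u t.
Proof. intros H; induction t; simpl; congruence. Qed.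

(** A renaming may identify variables; [bind_var] relies on this. *)
Lemma sat_rename {A : L2_structure} p :
  forall r R (v u : nat -> num A) (V U : nat -> set A),
  (forall i, u i = v (r i)) -> (forall i, U i = V (R i)) ->
  (sat v V (rename r R p) <-> sat u U p).
Proof.
  induction p; intros r R v u V U Hr HR; simpl;
    rewrite ?(eval_rename r _ v u Hr), ?HR; try tauto.
  1: rewrite (IHp r R v u V U); tauto.
  1-4: rewrite (IHp1 r R v u V U), (IHp2 r R v u V U); tauto.
  - split; intros H n; specialize (H n);
      apply (IHp (lift r) R (scons n v) (scons n u) V U) in H; auto;
      intros [|i]; simpl; auto.
  - split; intros [n H]; exists n;
      apply (IHp (lift r) R (scons n v) (scons n u) V U) in H; auto;
      intros [|i]; simpl; auto.
  - split; intros H X; specialize (H X);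
      apply (IHp r (lift R) v u (scons X V) (scons X U)) in H; auto;
      intros [|i]; simpl; auto.
  - split; intros [X H]; exists X;
      apply (IHp r (lift R) v u (scons X V) (scons X U)) in H; auto;
      intros [|i]; simpl; auto.
Qed.

(** * Dependence on finitely many number variables *)

Fixpoint tbound (t : term) : nat :=
  match t with
  | tvar i => S i
  | tzero | tone => O
  | tadd s t | tmul s t => Nat.max (tbound s) (tbound t)
  end.

Fixpoint vbound (p : formula) : nat :=
  match p with
  | feq s t | flt s t => Nat.max (tbound s) (tbound t)
  | fmem t _ => tbound t
  | fnot p | fallS p | fexS p => vbound p
  | fand p q | for_ p q | fimp p q | fiff p q => Nat.max (vbound p) (vbound q)
  | fall p | fex p => Nat.pred (vbound p)
  end.

Lemma eval_tbound {A : L2_structure} t (v u : nat -> num A) :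
  (forall i, i < tbound t -> v i = u i)%nat -> eval v t = eval u t.
Proof.
  induction t; simpl; intros H; auto;
    rewrite IHt1, IHt2; auto; intros i Hi; apply H; lia.
Qed.

(** Serves two purposes: it stands in for functional extensionality of valuations, and it bounds how
    many variables must be packed when a quantifier is eliminated. *)
Lemma sat_vbound {A : L2_structure} p :
  forall (v u : nat -> num A) (V : nat -> set A),
  (forall i, i < vbound p -> v i = u i)%nat -> (sat v V p <-> sat u V p).
Proof.
  induction p; intros v u V H; simpl in *.
  1-2: rewrite (eval_tbound s v u), (eval_tbound t v u);
    [tauto | intros i Hi; apply H; lia ..].
  1: rewrite (eval_tbound t v u); [tauto | auto].
  1: rewrite (IHp v u); tauto.
  1-4: rewrite (IHp1 v u), (IHp2 v u); [tauto | intros i Hi; apply H; lia ..].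
  - split; intros Hn n; specialize (Hn n);
      apply (IHp (scons n v) (scons n u) V); auto;
      intros [|i] Hi; simpl; auto; first [apply H; lia | symmetry; apply H; lia].
  - split; intros [n Hn]; exists n;
      apply (IHp (scons n v) (scons n u) V); auto;
      intros [|i] Hi; simpl; auto; first [apply H; lia | symmetry; apply H; lia].
  - split; intros Hn X; specialize (Hn X);
      apply (IHp v u (scons X V)); auto; intros; symmetry; auto.
  - split; intros [X Hn]; exists X;
      apply (IHp v u (scons X V)); auto; intros; symmetry; auto.
Qed.

(** * Definable predicates *)

(** Even positions carry [f] and odd ones [g], so that two formulas with unrelated parameters share
    a valuation after renaming by [dbl] and [dbl1]. *)
Definition interleave {T : Type} (f g : nat -> T) (i : nat) : T :=
  if Nat.even i then f (Nat.div2 i) else g (Nat.div2 i).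

Definition dbl (i : nat) : nat := 2 * i.
Definition dbl1 (i : nat) : nat := S (2 * i).

Lemma interleave_dbl {T} (f g : nat -> T) i : interleave f g (dbl i) = f i.
Proof.
  unfold interleave, dbl.
  replace (Nat.even (2 * i)) with true
    by (symmetry; apply Nat.even_spec; exists i; reflexivity).
  now rewrite Nat.div2_double.
Qed.

Lemma interleave_dbl1 {T} (f g : nat -> T) i : interleave f g (dbl1 i) = g i.
Proof.
  unfold interleave, dbl1.
  replace (Nat.even (S (2 * i))) with false.
  - now rewrite Nat.div2_succ_double.
  - symmetry. rewrite Nat.even_succ, <- Nat.negb_even.
    replace (Nat.even (2 * i)) with true
      by (symmetry; apply Nat.even_spec; exists i; reflexivity).
    reflexivity.
Qed.

(** The closure properties common to bounded and to arithmetical formulas, so that each definability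
    lemma is proved once for both. *)
Record formula_class (F : formula -> Prop) : Prop := {
  fc_bounded : forall p, bounded p -> F p;
  fc_not : forall p, F p -> F (fnot p);
  fc_and : forall p q, F p -> F q -> F (fand p q);
  fc_or : forall p q, F p -> F q -> F (for_ p q);
  fc_imp : forall p q, F p -> F q -> F (fimp p q);
  fc_iff : forall p q, F p -> F q -> F (fiff p q);
  fc_ball : forall t p, F p -> F (fall (fimp (flt (tvar 0) (tshift t)) p));
  fc_bex : forall t p, F p -> F (fex (fand (flt (tvar 0) (tshift t)) p));
  fc_rename : forall p r R, F p -> F (rename r R p)
}.

Lemma formula_class_bounded : formula_class bounded.
Proof. split; try (constructor; auto; fail); auto using bounded_rename. Qed.

Lemma formula_class_arithmetical : formula_class arithmetical.
Proof.
  split; simpl; auto using arithmetical_rename.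
  induction 1; simpl; auto.
Qed.

Section Definability.

Context {A : L2_structure}.
Notation env := (nat -> num A).

(* [inl j] refers to entry [j] of the valuation, [inr a] is the parameter [a]. *)
Definition lookup (e : nat -> nat + num A) (v : env) : env :=
  fun i => match e i with inl j => v j | inr a => a end.

Definition tdef (t : env -> num A) : Prop :=
  exists s e, forall v, t v = eval (lookup e v) s.

(** Definability with parameters: [e] supplies number parameters and [V] set parameters, both
    independent of [v]. *)
Definition def (F : formula -> Prop) (P : env -> Prop) : Prop :=
  exists p e V, F p /\ forall v, P v <-> sat (lookup e v) V p.

Lemma lookup_interleave_l e1 e2 (v : env) i :
  lookup e1 v i = lookup (interleave e1 e2) v (dbl i).
Proof. unfold lookup. now rewrite interleave_dbl. Qed.

Lemma lookup_interleave_r e1 e2 (v : env) i :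
  lookup e2 v i = lookup (interleave e1 e2) v (dbl1 i).
Proof. unfold lookup. now rewrite interleave_dbl1. Qed.

Lemma tdef_var i : tdef (fun v => v i).
Proof. exists (tvar i), inl. reflexivity. Qed.

Lemma tdef_const a : tdef (fun _ => a).
Proof. exists (tvar 0), (fun _ => inr a). reflexivity. Qed.

Lemma tdef_vars t (r : nat -> nat) : tdef t -> tdef (fun v => t (fun i => v (r i))).
Proof.
  intros (s & e & H).
  exists s, (fun i => match e i with inl j => inl (r j) | inr a => inr a end).
  intros v. rewrite H. apply eval_tbound. intros i _.
  unfold lookup. destruct (e i); reflexivity.
Qed.

Lemma tdef_merge t1 t2 : tdef t1 -> tdef t2 ->
  exists s1 s2 e, forall v,
    t1 v = eval (lookup e v) s1 /\ t2 v = eval (lookup e v) s2.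
Proof.
  intros (s1 & e1 & H1) (s2 & e2 & H2).
  exists (trename dbl s1), (trename dbl1 s2), (interleave e1 e2).
  intros v. rewrite H1, H2.
  rewrite (eval_rename dbl s1 _ (lookup e1 v)) by apply lookup_interleave_l.
  rewrite (eval_rename dbl1 s2 _ (lookup e2 v)) by apply lookup_interleave_r.
  auto.
Qed.

Lemma tdef_add t1 t2 : tdef t1 -> tdef t2 -> tdef (fun v => add (t1 v) (t2 v)).
Proof.
  intros H1 H2. destruct (tdef_merge _ _ H1 H2) as (s1 & s2 & e & H).
  exists (tadd s1 s2), e. intros v. destruct (H v) as [-> ->]. reflexivity.
Qed.

Lemma tdef_mul t1 t2 : tdef t1 -> tdef t2 -> tdef (fun v => mul (t1 v) (t2 v)).
Proof.
  intros H1 H2. destruct (tdef_merge _ _ H1 H2) as (s1 & s2 & e & H).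
  exists (tmul s1 s2), e. intros v. destruct (H v) as [-> ->]. reflexivity.
Qed.

Context {F : formula -> Prop} (hF : formula_class F).

Lemma def_ext (P Q : env -> Prop) :
  (forall v, Q v <-> P v) -> def F P -> def F Q.
Proof.
  intros E (p & e & V & hp & H). exists p, e, V. split; auto.
  intros v. now rewrite E.
Qed.

Lemma def_eq t1 t2 : tdef t1 -> tdef t2 -> def F (fun v => t1 v = t2 v).
Proof.
  intros H1 H2. destruct (tdef_merge _ _ H1 H2) as (s1 & s2 & e & H).
  destruct (set_inhabited A) as [X].
  exists (feq s1 s2), e, (fun _ => X). split.
  - apply (fc_bounded F hF). constructor.
  - intros v. simpl. destruct (H v) as [-> ->]. reflexivity.
Qed.

Lemma def_lt t1 t2 : tdef t1 -> tdef t2 -> def F (fun v => lt (t1 v) (t2 v)).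
Proof.
  intros H1 H2. destruct (tdef_merge _ _ H1 H2) as (s1 & s2 & e & H).
  destruct (set_inhabited A) as [X].
  exists (flt s1 s2), e, (fun _ => X). split.
  - apply (fc_bounded F hF). constructor.
  - intros v. simpl. destruct (H v) as [-> ->]. reflexivity.
Qed.

Lemma def_mem t X : tdef t -> def F (fun v => mem (t v) X).
Proof.
  intros (s & e & H). exists (fmem s 0), e, (fun _ => X). split.
  - apply (fc_bounded F hF). constructor.
  - intros v. simpl. rewrite H. reflexivity.
Qed.

Lemma def_merge P Q : def F P -> def F Q ->
  exists p q e V, F p /\ F q /\
    forall v, (P v <-> sat (lookup e v) V p) /\ (Q v <-> sat (lookup e v) V q).
Proof.
  intros (p & e1 & V1 & hp & H1) (q & e2 & V2 & hq & H2).
  exists (rename dbl dbl p), (rename dbl1 dbl1 q), (interleave e1 e2),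
    (interleave V1 V2).
  split; [|split]; [apply (fc_rename F hF); assumption .. |].
  intros v. rewrite H1, H2. split; symmetry; apply sat_rename;
    auto using lookup_interleave_l, lookup_interleave_r;
    intros i; [rewrite interleave_dbl | rewrite interleave_dbl1]; reflexivity.
Qed.

Lemma def_not P : def F P -> def F (fun v => ~ P v).
Proof.
  intros (p & e & V & hp & H). exists (fnot p), e, V.
  split; [apply (fc_not F hF); auto | intros v; simpl; rewrite H; tauto].
Qed.

Lemma def_and P Q : def F P -> def F Q -> def F (fun v => P v /\ Q v).
Proof.
  intros HP HQ. destruct (def_merge _ _ HP HQ) as (p & q & e & V & hp & hq & H).
  exists (fand p q), e, V. split; [apply (fc_and F hF); auto |].
  intros v; simpl; destruct (H v); tauto.
Qed.

Lemma def_or P Q : def F P -> def F Q -> def F (fun v => P v \/ Q v).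
Proof.
  intros HP HQ. destruct (def_merge _ _ HP HQ) as (p & q & e & V & hp & hq & H).
  exists (for_ p q), e, V. split; [apply (fc_or F hF); auto |].
  intros v; simpl; destruct (H v); tauto.
Qed.

Lemma def_imp (P Q : env -> Prop) :
  def F P -> def F Q -> def F (fun v => P v -> Q v).
Proof.
  intros HP HQ. destruct (def_merge _ _ HP HQ) as (p & q & e & V & hp & hq & H).
  exists (fimp p q), e, V. split; [apply (fc_imp F hF); auto |].
  intros v; simpl; destruct (H v); tauto.
Qed.

Lemma def_iff P Q : def F P -> def F Q -> def F (fun v => P v <-> Q v).
Proof.
  intros HP HQ. destruct (def_merge _ _ HP HQ) as (p & q & e & V & hp & hq & H).
  exists (fiff p q), e, V. split; [apply (fc_iff F hF); auto |].
  intros v; simpl; destruct (H v); tauto.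
Qed.

Lemma def_vars P (r : nat -> nat) : def F P -> def F (fun v => P (fun i => v (r i))).
Proof.
  intros (p & e & V & hp & H).
  exists p, (fun i => match e i with inl j => inl (r j) | inr a => inr a end), V.
  split; auto. intros v. rewrite H.
  apply sat_vbound. intros i _. unfold lookup. destruct (e i); reflexivity.
Qed.

(* Several formula variables may stand for entry 0 of the valuation; binding that
   entry sends all of them to variable 0. *)
Definition unbind (e : nat -> nat + num A) : nat -> nat + num A :=
  fun i => match e i with inl (S j) => inl j | inl O => inr zero | inr a => inr a end.

Definition bind_var (e : nat -> nat + num A) (r : nat -> nat) : nat -> nat :=
  fun i => match e i with inl O => O | _ => S (r i) end.

Lemma lookup_bind e r n (v u : env) :
  (forall i, lookup (unbind e) v i = u (r i)) ->
  forall i, lookup e (fun j => match j with O => n | S k => v k end) i =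
    scons n u (bind_var e r i).
Proof.
  intros H i. specialize (H i). unfold lookup, unbind, bind_var in *.
  destruct (e i) as [[|j]|a]; simpl; auto.
Qed.

(** Common core of all quantifier lemmas: bound and body share one environment, and variable 0 of
    [p] is ready to be bound. Unbounded quantifiers use it with the dummy bound [zero]. *)
Lemma def_bind t (R : env -> num A -> Prop) :
  tdef t -> def F (fun w => R (fun i => w (S i)) (w 0%nat)) ->
  exists s p e V, F p /\ forall v,
    t v = eval (lookup e v) s /\
    forall n, R v n <-> sat (scons n (lookup e v)) V p.
Proof.
  intros (s & e1 & Hs) (p & e2 & V & hp & H).
  exists (trename dbl s), (rename (bind_var e2 dbl1) (fun i => i) p),
    (interleave e1 (unbind e2)), V.
  split; [apply (fc_rename F hF); assumption|].
  intros v. split.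
  - rewrite Hs. symmetry. apply eval_rename, lookup_interleave_l.
  - intros n.
    rewrite (sat_rename p _ _ _
      (lookup e2 (fun j => match j with O => n | S k => v k end)) _ V).
    + rewrite <- H. reflexivity.
    + apply lookup_bind. apply lookup_interleave_r.
    + reflexivity.
Qed.

Lemma def_ball t (R : env -> num A -> Prop) :
  tdef t -> def F (fun w => R (fun i => w (S i)) (w 0%nat)) ->
  def F (fun v => forall n, lt n (t v) -> R v n).
Proof.
  intros Ht HR. destruct (def_bind t R Ht HR) as (s & p & e & V & hp & H).
  exists (fall (fimp (flt (tvar 0) (tshift s)) p)), e, V.
  split; [apply (fc_ball F hF); auto |].
  intros v. destruct (H v) as [-> Hn]. simpl.
  assert (E : forall n, eval (scons n (lookup e v)) (tshift s)
                = eval (lookup e v) s).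
  { intros n. rewrite tshift_trename. apply eval_rename. reflexivity. }
  split; intros K n Hlt; specialize (K n).
  - apply Hn, K. now rewrite <- (E n).
  - apply Hn, K. now rewrite (E n).
Qed.

Lemma def_bex t (R : env -> num A -> Prop) :
  tdef t -> def F (fun w => R (fun i => w (S i)) (w 0%nat)) ->
  def F (fun v => exists n, lt n (t v) /\ R v n).
Proof.
  intros Ht HR. destruct (def_bind t R Ht HR) as (s & p & e & V & hp & H).
  exists (fex (fand (flt (tvar 0) (tshift s)) p)), e, V.
  split; [apply (fc_bex F hF); auto |].
  intros v. destruct (H v) as [-> Hn]. simpl.
  assert (E : forall n, eval (scons n (lookup e v)) (tshift s)
                = eval (lookup e v) s).
  { intros n. rewrite tshift_trename. apply eval_rename. reflexivity. }
  split; intros [n [Hlt K]]; exists n.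
  - split; [now rewrite (E n) | now apply Hn].
  - split; [now rewrite <- (E n) | now apply Hn].
Qed.

End Definability.

Lemma def_ex {A : L2_structure} (R : (nat -> num A) -> num A -> Prop) :
  def arithmetical (fun w => R (fun i => w (S i)) (w 0%nat)) ->
  def arithmetical (fun v => exists n, R v n).
Proof.
  intros HR.
  destruct (def_bind formula_class_arithmetical (fun _ => zero) R
    (tdef_const zero) HR) as (s & p & e & V & hp & H).
  exists (fex p), e, V. split; auto.
  intros v. destruct (H v) as [_ Hn]. simpl.
  split; intros [n K]; exists n; apply Hn; auto.
Qed.

Lemma def_all {A : L2_structure} (R : (nat -> num A) -> num A -> Prop) :
  def arithmetical (fun w => R (fun i => w (S i)) (w 0%nat)) ->
  def arithmetical (fun v => forall n, R v n).
Proof.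
  intros HR.
  destruct (def_bind formula_class_arithmetical (fun _ => zero) R
    (tdef_const zero) HR) as (s & p & e & V & hp & H).
  exists (fall p), e, V. split; auto.
  intros v. destruct (H v) as [_ Hn]. simpl.
  split; intros K n; apply Hn; auto.
Qed.

Ltac tsolve :=
  lazymatch goal with
  | |- tdef (fun v => v ?i) => apply tdef_var
  | |- tdef (fun v => add _ _) => apply tdef_add; tsolve
  | |- tdef (fun v => mul _ _) => apply tdef_mul; tsolve
  | |- tdef (fun v => pair _ _) => unfold pair; tsolve
  | |- tdef (fun v => triple _ _ _) => unfold triple, pair; tsolve
  | |- tdef (fun v => ?a) => apply tdef_const
  end.

Create HintDb definability.

(* The case [?Q (v ?i) (v ?j)] must precede [?Q (v ?i)], where [?Q] could be
   instantiated by a term containing [v]. *)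
Ltac dsolve :=
  cbv beta;
  lazymatch goal with
  | |- def ?F ?P =>
    let hF := lazymatch F with
      | bounded => constr:(formula_class_bounded)
      | arithmetical => constr:(formula_class_arithmetical)
      end in
    lazymatch P with
    | (fun v => @eq (num _) _ _) => apply (def_eq hF); tsolve
    | (fun v => lt _ _) => apply (def_lt hF); tsolve
    | (fun v => mem _ _) => apply (def_mem hF); tsolve
    | (fun v => ~ _) => apply (def_not hF); dsolve
    | (fun v => _ /\ _) => apply (def_and hF); dsolve
    | (fun v => _ \/ _) => apply (def_or hF); dsolve
    | (fun v => _ <-> _) => apply (def_iff hF); dsolve
    | (fun v => forall n, lt n _ -> _) => apply (def_ball hF); [tsolve | dsolve]
    | (fun v => exists n, lt n _ /\ _) => apply (def_bex hF); [tsolve | dsolve]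
    | (fun v => forall n : num _, _) => apply def_all; dsolve
    | (fun v => exists n : num _, _) => apply def_ex; dsolve
    | (fun v => _ -> _) => apply (def_imp hF); dsolve
    | (fun v => ?Q (v ?i) (v ?j)) =>
      first [solve [auto with definability] |
        match goal with H : def F (fun v => Q (v O) (v 1%nat)) |- _ =>
        exact (def_vars (fun v => Q (v O) (v 1%nat))
          (fun k : nat => match k with O => i | _ => j end) H) end]
    | (fun v => ?Q (v ?i)) =>
      first [solve [auto with definability] |
        match goal with H : def F (fun v => Q (v O)) |- _ =>
        exact (def_vars (fun v => Q (v O)) (fun _ => i) H) end]
    | _ => solve [auto with definability]
    end
  end.

(** * Arithmetic in RCA_0 *)

Section Arithmetic.

Context {A : L2_structure} (hA : RCA0 A).
Local Open Scope L2_scope.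
Implicit Types (k m n q x y z a b c d : num A).

Lemma Sigma1_ind (R : num A -> num A -> Prop) :
  def bounded (fun v => R (v 0%nat) (v 1%nat)) ->
  (exists m, R 0 m) ->
  (forall n, (exists m, R n m) -> exists m, R (n + 1) m) ->
  forall n, exists m, R n m.
Proof.
  intros (p & e & V & hp & H) H0 HS.
  (* The existential quantifier binds variable 0, so [m] (entry 1) becomes variable 0 and [n] (entry
     0) variable 1; everything else is shifted past both and read from [u], where leftover entries
     get the value zero. *)
  set (r := fun i : nat => match e i with
    | inl O => 1%nat | inl (S O) => O | _ => S (S i) end).
  set (u := fun i : nat => match e i with inl _ => @zero A | inr a => a end).
  set (z := fun _ : nat => @zero A).
  set (p' := fex (rename r (fun i : nat => i) p)).
  assert (E : forall n, sat (scons n u) V p' <-> exists m, R n m).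
  { intros n. simpl.
    assert (G : forall m, sat (scons m (scons n u)) V (rename r (fun i : nat => i) p)
                     <-> R n m).
    { intros m.
      transitivity (sat (lookup e (scons n (scons m z))) V p).
      - apply sat_rename; [|reflexivity]. intros i. unfold lookup, r.
        destruct (e i) as [[|[|j]]|a] eqn:Ei; simpl; auto;
          unfold u, z; rewrite Ei; reflexivity.
      - symmetry. apply (H (scons n (scons m z))). }
    split; intros [m Hm]; exists m; apply G, Hm. }
  assert (S1 : Sigma01 p').
  { exists (rename r (fun i : nat => i) p). split; [apply bounded_rename|]; auto. }
  intros n. apply E. apply (RCA0_induction A hA p' S1 u V).
  - apply E, H0.
  - intros k Hk. apply E, HS, E, Hk.
Qed.

Lemma Delta0_ind (P : num A -> Prop) :
  def bounded (fun v => P (v 0%nat)) ->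
  P 0 -> (forall n, P n -> P (n + 1)) -> forall n, P n.
Proof.
  intros HP H0 HS n.
  destruct (Sigma1_ind (fun n _ => P n)) with (n := n) as [_ K]; auto.
  - exists 0. exact H0.
  - intros k [m Hk]. exists m. auto.
Qed.

Lemma Delta0_comprehension (P : num A -> Prop) :
  def bounded (fun v => P (v 0%nat)) -> exists X : set A, forall n, n ∈ X <-> P n.
Proof.
  intros (p & e & V & hp & H).
  set (r := fun i : nat => match e i with inl O => O | _ => S i end).
  set (u := fun i : nat => match e i with inl _ => @zero A | inr a => a end).
  set (z := fun _ : nat => @zero A).
  (* [p'] does not mention variable 0, so a dummy quantifier makes it both Sigma^0_1 and Pi^0_1. *)
  set (p' := rename (fun i : nat => S (r i)) (fun i : nat => i) p).
  assert (E : forall n m, sat (scons m (scons n u)) V p' <-> P n).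
  { intros n m. transitivity (sat (lookup e (scons n z)) V p).
    - apply sat_rename; [|reflexivity]. intros i. unfold lookup, r.
      destruct (e i) as [[|j]|a] eqn:Ei; simpl; auto;
        unfold u, z; rewrite Ei; reflexivity.
    - symmetry. apply (H (scons n z)). }
  assert (hp' : bounded p') by (apply bounded_rename; auto).
  destruct (RCA0_comprehension A hA (fex p') (fall p')) with (v := u) (V := V)
    as [X HX].
  - now exists p'.
  - now exists p'.
  - intros n. simpl. split.
    + intros [m Hm] m'. apply E. now apply E in Hm.
    + intros Hm. exists 0. auto.
  - exists X. intros n. rewrite HX. simpl. split.
    + intros [m Hm]. now apply E in Hm.
    + intros Hn. exists 0. now apply E.
Qed.

Let succ_neq0 := ax_succ_neq0 A (RCA0_basic A hA).
Let succ_inj := ax_succ_inj A (RCA0_basic A hA).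
Let add0 := ax_add0 A (RCA0_basic A hA).
Let addS := ax_addS A (RCA0_basic A hA).
Let mul0 := ax_mul0 A (RCA0_basic A hA).
Let mulS := ax_mulS A (RCA0_basic A hA).
Let lt0 := ax_lt0 A (RCA0_basic A hA).
Let ltS := ax_ltS A (RCA0_basic A hA).

(** Induction in the structure requires a definable goal; [dsolve] finds the bounded formula, the
    other numbers being parameters. *)
Ltac ind n :=
  pattern n;
  lazymatch goal with |- ?P n => revert n; refine (Delta0_ind P _ _ _) end;
  cbv beta; [dsolve | | intros n].

Lemma add_assoc x y z : x + (y + z) = x + y + z.
Proof.
  ind z.
  - now rewrite !add0.
  - intros IH. now rewrite !addS, IH.
Qed.

Lemma add_0_l x : 0 + x = x.
Proof. ind x; [apply add0 | intros IH; now rewrite addS, IH]. Qed.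

Lemma add_succ_l x y : x + 1 + y = x + y + 1.
Proof. ind y; [now rewrite !add0 | intros IH; now rewrite !addS, IH]. Qed.

Lemma add_comm x y : x + y = y + x.
Proof.
  ind y.
  - now rewrite add0, add_0_l.
  - intros IH. now rewrite addS, add_succ_l, IH.
Qed.

Lemma mul_0_l x : 0 * x = 0.
Proof. ind x; [apply mul0 | intros IH; now rewrite mulS, IH, add0]. Qed.

Lemma mul_succ_l x y : (x + 1) * y = x * y + y.
Proof.
  ind y; [now rewrite !mul0, add0 |].
  intros IH. rewrite !mulS, IH, <- !add_assoc. f_equal.
  rewrite !addS. now rewrite (add_comm y x).
Qed.

Lemma mul_comm x y : x * y = y * x.
Proof.
  ind y.
  - now rewrite mul0, mul_0_l.
  - intros IH. now rewrite mulS, mul_succ_l, IH.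
Qed.

Lemma mul_add_distr_r x y z : (x + y) * z = x * z + y * z.
Proof.
  ind z; [now rewrite !mul0, add0 |].
  intros IH. rewrite !mulS, IH, <- !add_assoc. f_equal.
  rewrite !add_assoc. now rewrite (add_comm (y * z) x).
Qed.

Lemma mul_assoc x y z : x * (y * z) = x * y * z.
Proof.
  ind x; [now rewrite !mul_0_l |].
  intros IH. now rewrite !mul_succ_l, IH, mul_add_distr_r.
Qed.

Lemma mul_1_l x : 1 * x = x.
Proof.
  rewrite <- (add_0_l 1), mul_succ_l, mul_0_l. apply add_0_l.
Qed.

Definition num_semiring :
  semi_ring_theory (@zero A) one add mul (@eq (num A)) :=
  mk_srt zero one add mul eq add_0_l add_comm add_assoc mul_1_l mul_0_l mul_comm
    mul_assoc mul_add_distr_r.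
Add Ring num_ring : num_semiring.

Lemma add_cancel_r x y z : x + z = y + z -> x = y.
Proof.
  ind z; [now rewrite !add0 |].
  intros IH H. rewrite !addS in H. auto.
Qed.

Lemma add_cancel_l x y z : z + x = z + y -> x = y.
Proof. rewrite !(add_comm z). apply add_cancel_r. Qed.

Lemma add_succ_neq x y : x <> x + (y + 1).
Proof.
  intros H. apply (succ_neq0 y). apply (add_cancel_l _ _ x).
  now rewrite add0.
Qed.

Lemma zero_or_succ x : x = 0 \/ exists y, x = y + 1.
Proof.
  (* The bound on [y] keeps the induction statement bounded. *)
  assert (H : x = 0 \/ exists y, y < x /\ x = y + 1).
  { ind x; [now left |]. intros _. right. exists x. split; auto.
    apply ltS. now right. }
  destruct H as [H|(y & _ & H)]; eauto.
Qed.

Lemma lt_add x d : x < x + (d + 1).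
Proof.
  ind d.
  - rewrite add_0_l. apply ltS. now right.
  - intros IH. rewrite addS. apply ltS. now left.
Qed.

Lemma lt_ex x y : x < y -> exists d, y = x + (d + 1).
Proof.
  intros H.
  (* The hypothesis [x < y] moves under the existential quantifier, which makes the statement
     Sigma^0_1. *)
  destruct (Sigma1_ind (fun y d => x < y -> y = x + (d + 1))) with (n := y)
    as [d Hd]; [dsolve | | | eauto].
  - exists 0. intros K. now apply lt0 in K.
  - intros n [d Hd]. destruct (classic (x < n)) as [K|K].
    + exists (d + 1). intros _. rewrite (Hd K) at 1. ring.
    + exists 0. rewrite ltS. intros [K'|K']; [tauto|]. rewrite K'. ring.
Qed.

Lemma lt_irrefl x : ~ x < x.
Proof. intros H. destruct (lt_ex _ _ H) as [d Hd]. now apply add_succ_neq in Hd. Qed.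

Lemma lt_trans x y z : x < y -> y < z -> x < z.
Proof.
  intros H K. destruct (lt_ex _ _ H) as [d ->]. destruct (lt_ex _ _ K) as [d' ->].
  replace (x + (d + 1) + (d' + 1)) with (x + ((d + d' + 1) + 1)) by ring.
  apply lt_add.
Qed.

Lemma lt_succ x : x < x + 1.
Proof. apply ltS. now right. Qed.

Lemma pos x : x = 0 \/ 0 < x.
Proof.
  destruct (zero_or_succ x) as [->|[y ->]]; auto. right.
  rewrite <- (add_0_l (y + 1)). apply lt_add.
Qed.

Lemma lt_total x y : x < y \/ x = y \/ y < x.
Proof.
  ind x.
  - destruct (pos y) as [->|H]; auto.
  - intros [H|[->|H]].
    + destruct (lt_ex _ _ H) as [d ->]. destruct (zero_or_succ d) as [->|[d' ->]].
      * right; left. ring.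
      * left. replace (x + (d' + 1 + 1)) with (x + 1 + (d' + 1)) by ring.
        apply lt_add.
    + right; right. apply lt_succ.
    + right; right. apply ltS. auto.
Qed.

Lemma le_total x y : (exists d, y = x + d) \/ exists d, x = y + (d + 1).
Proof.
  destruct (lt_total x y) as [H|[->|H]].
  - left. destruct (lt_ex _ _ H) as [d ->]. eauto.
  - left. exists 0. now rewrite add0.
  - right. now apply lt_ex.
Qed.

Lemma le_lt_succ x d : x < x + d + 1.
Proof. replace (x + d + 1) with (x + (d + 1)) by ring. apply lt_add. Qed.

Lemma le_trans x y z : x < y + 1 -> y < z + 1 -> x < z + 1.
Proof. rewrite (ltS x y). intros [H | ->] K; eauto using lt_trans. Qed.

Lemma lt_mono_succ x y : x < y -> x + 1 < y + 1.
Proof.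
  intros H. destruct (lt_ex _ _ H) as [d ->].
  replace (x + (d + 1) + 1) with (x + 1 + (d + 1)) by ring. apply lt_add.
Qed.

Lemma least_number (P : num A -> Prop) :
  def bounded (fun v => P (v 0%nat)) -> (exists n, P n) ->
  exists n, P n /\ forall m, m < n -> ~ P m.
Proof.
  intros HP [n Hn]. apply NNPP. intros K.
  assert (H : forall n, forall m, m < n -> ~ P m).
  { refine (Delta0_ind (fun n => forall m, m < n -> ~ P m) _ _ _).
    - dsolve.
    - intros m Hm. now apply lt0 in Hm.
    - intros k IH m Hm. apply ltS in Hm. destruct Hm as [Hm| ->]; auto.
      intros Hk. apply K. eauto. }
  exact (H (n + 1) n (lt_succ n) Hn).
Qed.

Lemma strong_ind (P : num A -> Prop) :
  def bounded (fun v => P (v 0%nat)) ->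
  (forall n, (forall m, m < n -> P m) -> P n) -> forall n, P n.
Proof.
  intros HP H n. apply NNPP. intros Hn.
  destruct (least_number (fun n => ~ P n)) as (k & Hk & Hl); eauto.
  - dsolve.
  - apply Hk, H. intros m Hm. apply NNPP. auto.
Qed.

(** The square dominates: with s = i + j, the next square exceeds s^2 by 2s + 1 > i, so equal pairs
    have equal sums. *)
Lemma pair_inj (i j i' j' : num A) : pair i j = pair i' j' -> i = i' /\ j = j'.
Proof.
  unfold pair. intros H.
  assert (K : forall (i j i' j' d : num A),
    (i + j) * (i + j) + i = (i' + j') * (i' + j') + i' ->
    i' + j' = i + j + (d + 1) -> False).
  { intros x y x' y' d H1 H2. rewrite H2 in H1.
    (* The second argument is one less than the excess of the second pair over the first. *)
    apply (add_succ_neq ((x + y) * (x + y) + x)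
      (x + y + y + (x + y) * d + (x + y) * d + (d + 1) * d + d + x')).
    rewrite H1 at 1. ring. }
  destruct (lt_total (i + j) (i' + j')) as [L|[E|L]].
  - destruct (lt_ex _ _ L) as [d Hd]. destruct (K _ _ _ _ _ H Hd).
  - rewrite E in H. apply add_cancel_l in H. subst i'.
    apply add_cancel_l in E. auto.
  - destruct (lt_ex _ _ L) as [d Hd]. destruct (K _ _ _ _ _ (eq_sym H) Hd).
Qed.

Lemma pair_l (i j : num A) : i < pair i j + 1.
Proof.
  unfold pair. replace ((i + j) * (i + j) + i) with (i + (i + j) * (i + j)) by ring.
  apply le_lt_succ.
Qed.

Lemma pair_r (i j : num A) : j < pair i j + 1.
Proof.
  unfold pair. destruct (zero_or_succ j) as [->|[d ->]].
  - destruct (pos ((i + 0) * (i + 0) + i)) as [->|H].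
    + apply lt_succ.
    + apply ltS; auto.
  - replace ((i + (d + 1)) * (i + (d + 1)) + i)
      with (d + 1 + (i * i + i * (d + 1) + i * (d + 1) + d * d + d + i)) by ring.
    apply le_lt_succ.
Qed.

Lemma triple_1 k m n : k < triple k m n + 1.
Proof. apply pair_l. Qed.

Lemma triple_2 k m n : m < triple k m n + 1.
Proof. exact (le_trans _ _ _ (pair_l m n) (pair_r k (pair m n))). Qed.

Lemma triple_3 k m n : n < triple k m n + 1.
Proof. exact (le_trans _ _ _ (pair_r m n) (pair_r k (pair m n))). Qed.

Lemma triple_inj k m n k' m' n' :
  triple k m n = triple k' m' n' -> k = k' /\ m = m' /\ n = n'.
Proof.
  intros H. apply pair_inj in H. destruct H as [? H]. apply pair_inj in H. tauto.
Qed.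

(** For [m = 0] the quotient 0 is chosen; otherwise every quotient is at most [n]. Hence
    divisibility is bounded definable. *)
Lemma divides_bound m n : divides m n <-> exists q, q < n + 1 /\ n = m * q.
Proof.
  split; [|intros (q & _ & H); now exists q].
  intros [q H]. destruct (zero_or_succ m) as [->|[m' ->]].
  - exists 0. rewrite H. split; [|ring]. rewrite mul_0_l. apply lt_succ.
  - exists q. split; auto. rewrite H.
    replace ((m' + 1) * q) with (q + m' * q) by ring. apply le_lt_succ.
Qed.

(** * Finite sets *)

(** Naming the value of [s] by a bounded quantifier replaces substitution of terms into formulas. *)
Lemma def_subst1 (F : formula -> Prop) (hF : formula_class F)
    (P : num A -> Prop) (s : (nat -> num A) -> num A) :
  def F (fun v => P (v 0%nat)) -> tdef s -> def F (fun v => P (s v)).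
Proof.
  intros HP Hs.
  apply (def_ext (fun v => exists x, x < s v + 1 /\ x = s v /\ P x)).
  - intros v. split; [intros H; exists (s v); auto using lt_succ |].
    now intros (x & _ & -> & H).
  - apply (def_bex hF).
    + apply tdef_add; [exact Hs | tsolve].
    + apply (def_and hF).
      * apply (def_eq hF); [tsolve | exact (tdef_vars _ S Hs)].
      * exact HP.
Qed.

Lemma def_subst2 (F : formula -> Prop) (hF : formula_class F)
    (P : num A -> num A -> Prop) (s t : (nat -> num A) -> num A) :
  def F (fun v => P (v 0%nat) (v 1%nat)) -> tdef s -> tdef t ->
  def F (fun v => P (s v) (t v)).
Proof.
  intros HP Hs Ht.
  apply (def_ext (fun v => exists x, x < s v + 1 /\ x = s v /\
    exists y, y < t v + 1 /\ y = t v /\ P x y)).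
  - intros v. split.
    + intros H. exists (s v). do 2 (split; auto using lt_succ).
      exists (t v). auto using lt_succ.
    + now intros (x & _ & -> & y & _ & -> & H).
  - apply (def_bex hF); [apply tdef_add; [exact Hs | tsolve] |].
    apply (def_and hF).
    { apply (def_eq hF); [tsolve | exact (tdef_vars _ S Hs)]. }
    apply (def_bex hF).
    { apply tdef_add; [exact (tdef_vars _ S Ht) | tsolve]. }
    apply (def_and hF).
    { apply (def_eq hF); [tsolve | exact (tdef_vars _ (fun i : nat => S (S i)) Ht)]. }
    exact (def_vars _ (fun k : nat => match k with O => 1%nat | _ => O end) HP).
Qed.

Lemma def_of_bounded (F : formula -> Prop) (hF : formula_class F)
    (P : (nat -> num A) -> Prop) : def bounded P -> def F P.
Proof.
  intros (p & e & V & hp & H). exists p, e, V. split; auto.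
  now apply (fc_bounded F hF).
Qed.

Lemma def_divides (F : formula -> Prop) (hF : formula_class F)
    (s t : (nat -> num A) -> num A) :
  tdef s -> tdef t -> def F (fun v => divides (s v) (t v)).
Proof.
  apply (def_subst2 F hF divides), (def_of_bounded F hF).
  apply (def_ext (fun v => exists q, q < v 1%nat + 1 /\ v 1%nat = v 0%nat * q)).
  - intros v. apply divides_bound.
  - dsolve.
Qed.

Hint Extern 1 (formula_class bounded) =>
  exact formula_class_bounded : definability.
Hint Extern 1 (formula_class arithmetical) =>
  exact formula_class_arithmetical : definability.
Hint Extern 1 (tdef _) => tsolve : definability.
Hint Resolve def_divides : definability.

Definition is_triple c : Prop := exists k m n, c = triple k m n.

Lemma def_is_triple (F : formula -> Prop) (hF : formula_class F)
    (s : (nat -> num A) -> num A) :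
  tdef s -> def F (fun v => is_triple (s v)).
Proof.
  apply (def_subst1 F hF is_triple), (def_of_bounded F hF).
  apply (def_ext (fun v => exists k, k < v 0%nat + 1 /\
    exists m, m < v 0%nat + 1 /\ exists n, n < v 0%nat + 1 /\
    v 0%nat = triple k m n)).
  - intros v. split.
    + intros (k & m & n & ->). exists k. split; [apply triple_1|].
      exists m. split; [apply triple_2|]. exists n. split; [apply triple_3|]. auto.
    + intros (k & _ & m & _ & n & _ & H). now exists k, m, n.
  - dsolve.
Qed.

Lemma fmember_triple i k m n :
  fmember i (triple k m n) <-> i < k /\ divides (m * (i + 1) + 1) n.
Proof.
  split.
  - intros (k' & m' & n' & H & K). apply triple_inj in H.
    destruct H as (-> & -> & ->). exact K.
  - intros H. now exists k, m, n.
Qed.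

Lemma fmember_lt i c : fmember i c -> i < c + 1.
Proof. intros (k & m & n & -> & H & _). exact (lt_trans _ _ _ H (triple_1 k m n)). Qed.

Lemma def_fmember (F : formula -> Prop) (hF : formula_class F)
    (s t : (nat -> num A) -> num A) :
  tdef s -> tdef t -> def F (fun v => fmember (s v) (t v)).
Proof.
  apply (def_subst2 F hF fmember), (def_of_bounded F hF).
  apply (def_ext (fun v => exists k, k < v 1%nat + 1 /\
    exists m, m < v 1%nat + 1 /\ exists n, n < v 1%nat + 1 /\
    v 1%nat = triple k m n /\ v 0%nat < k /\ divides (m * (v 0%nat + 1) + 1) n)).
  - intros v. split.
    + intros (k & m & n & -> & H). exists k. split; [apply triple_1|].
      exists m. split; [apply triple_2|]. exists n. split; [apply triple_3|]. auto.
    + intros (k & _ & m & _ & n & _ & H). now exists k, m, n.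
  - dsolve.
Qed.

Hint Resolve def_is_triple def_fmember : definability.

Lemma def_is_code (F : formula -> Prop) (hF : formula_class F)
    (s : (nat -> num A) -> num A) :
  tdef s -> def F (fun v => is_code (s v)).
Proof.
  apply (def_subst1 F hF is_code), (def_of_bounded F hF).
  (* With [c' < c], all elements of both sets lie below [c + 1], so comparing them takes only
     bounded [i]. *)
  apply (def_ext (fun v => is_triple (v 0%nat) /\ forall c', c' < v 0%nat ->
    is_triple c' ->
    ~ (forall i, i < v 0%nat + 1 -> (fmember i c' <-> fmember i (v 0%nat))))).
  - intros v. generalize (v 0%nat) as c. intros c.
    split; intros [H1 H2]; (split; [exact H1|]); intros c' Hc Ht K;
      apply (H2 c' Hc Ht); auto.
    intros i. split; intros Hi; (apply K; [|exact Hi]).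
    + eauto using lt_trans, lt_mono_succ, fmember_lt.
    + now apply fmember_lt.
  - dsolve.
Qed.

Hint Resolve def_is_code : definability.

Lemma code_of_triple c0 : is_triple c0 ->
  exists c, is_code c /\ forall i, fmember i c <-> fmember i c0.
Proof.
  intros H0.
  destruct (least_number (fun c => c < c0 + 1 /\ is_triple c /\
    forall i, i < c0 + 1 -> (fmember i c <-> fmember i c0)))
    as (c & (Hc & Ht & Hi) & Hl).
  - dsolve.
  - exists c0. split; [apply lt_succ|]. split; [exact H0 | reflexivity].
  - assert (Hi' : forall i, fmember i c <-> fmember i c0).
    { intros i. split; intros K; (apply Hi; [|exact K]).
      - eauto using le_trans, fmember_lt.
      - now apply fmember_lt. }
    exists c. split; [split; [exact Ht|] | exact Hi'].
    intros c' Hc' Ht' K. apply (Hl c' Hc'). split; [eauto using lt_trans|].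
    split; [exact Ht'|]. intros i _. now rewrite K, Hi'.
Qed.

(** * Divisibility and Gödel's coding of bounded sets *)

Lemma divides_mul_r a x y : divides a x -> divides a (x * y).
Proof. intros [q ->]. exists (q * y). ring. Qed.

Lemma divides_add_cancel a x y : divides a (x + y) -> divides a x -> divides a y.
Proof.
  intros [q Hq] [p ->]. destruct (le_total p q) as [[d ->]|[d ->]].
  - exists d. apply (add_cancel_l _ _ (a * p)). rewrite Hq. ring.
  - assert (K : a * (d + 1) + y = 0).
    { apply (add_cancel_l _ _ (a * q)). rewrite add0. rewrite <- Hq at 2. ring. }
    exists 0. destruct (zero_or_succ y) as [->|[y' ->]]; [ring|].
    rewrite addS in K. now apply succ_neq0 in K.
Qed.

(* Let [m = (d+1) q], [a = m(i+1)+1], [b = m(j+1)+1] and [s = m(i+1)].  Modulo [a]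
   we have [s = -1], so [b q (i+1)^2] is [s^2 = 1] or [-s^2 = -1]. *)
Lemma divides_coprime i j d q n :
  j = i + (d + 1) \/ i = j + (d + 1) ->
  divides ((d + 1) * q * (i + 1) + 1) (n * ((d + 1) * q * (j + 1) + 1)) ->
  divides ((d + 1) * q * (i + 1) + 1) n.
Proof.
  intros Hij H. set (s := (d + 1) * q * (i + 1)) in *.
  apply (fun h => divides_mul_r _ _ (q * (i + 1) * (i + 1)) h) in H.
  destruct Hij as [-> | Hi].
  - apply (divides_add_cancel (s + 1)
      ((s + 1) * (n * (q * (i + 1) * (i + 1)) + n * s))).
    + replace ((s + 1) * (n * (q * (i + 1) * (i + 1)) + n * s) + n)
        with (n * ((d + 1) * q * (i + (d + 1) + 1) + 1) * (q * (i + 1) * (i + 1))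
              + (s + 1) * n) by (unfold s; ring).
      destruct H as [p ->]. exists (p + n). ring.
    + exists (n * (q * (i + 1) * (i + 1)) + n * s). ring.
  - apply (divides_add_cancel (s + 1)
      (n * ((d + 1) * q * (j + 1) + 1) * (q * (i + 1) * (i + 1)) + (s + 1) * (n * s))).
    + exists (n * (q * (i + 1) * (i + 1)) + n).
      unfold s. rewrite Hi. ring.
    + destruct H as [p ->]. exists (p + n * s). ring.
Qed.

(** In effect [m] is the factorial of [k], obtained by Sigma^0_1 induction; [m <> 0] keeps the
    moduli m(i+1)+1 above 1. *)
Lemma common_multiple k :
  exists m, m <> 0 /\ forall d, d < k -> divides (d + 1) m.
Proof.
  revert k. apply Sigma1_ind; [dsolve | |].
  - exists 1. split.
    + rewrite <- (add_0_l 1). apply succ_neq0.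
    + intros d Hd. now apply lt0 in Hd.
  - intros k (m & Hm & Hd). exists (m * (k + 1)). split.
    + destruct (zero_or_succ m) as [->|[m' ->]]; [now destruct Hm|].
      replace ((m' + 1) * (k + 1)) with (m' * k + m' + k + 1) by ring.
      apply succ_neq0.
    + intros d K. apply ltS in K. destruct K as [K| ->].
      * apply divides_mul_r; auto.
      * exists m. ring.
Qed.

(** [n] is the product of the moduli m(i+1)+1 with [i < k] in [S], built factor by factor; by
    coprimality no other modulus below [k] divides it. *)
Lemma bounded_set_code (S : set A) k :
  exists m n, forall i, i < k -> (divides (m * (i + 1) + 1) n <-> i ∈ S).
Proof.
  destruct (common_multiple k) as (m & Hm & Hd). exists m.
  destruct (Sigma1_ind (fun j n => forall i, i < k ->
    (divides (m * (i + 1) + 1) n <-> i < j /\ i ∈ S))) with (n := k)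
    as [n Hn].
  - dsolve.
  (* The empty product: no modulus divides 1, since [m] is nonzero. *)
  - exists 1. intros i _. split; [|intros [K _]; now apply lt0 in K].
    intros [x Hx]. exfalso.
    destruct (zero_or_succ m) as [->|[m' ->]]; [now destruct Hm|].
    destruct (zero_or_succ x) as [->|[x' ->]].
    + rewrite mul0 in Hx. apply (succ_neq0 0). now rewrite add_0_l.
    + apply (succ_neq0 (m' * i + m' + i + ((m' + 1) * (i + 1) + 1) * x')).
      apply (add_cancel_r _ _ 1). rewrite add_0_l. rewrite Hx at 6. ring.
  - intros j [n Hn].
    destruct (classic (j ∈ S)) as [Hj|Hj].
    + destruct (classic (j < k)) as [Hjk|Hjk].
      * exists (n * (m * (j + 1) + 1)). intros i Hi. rewrite ltS. split.
        -- intros H. destruct (lt_total i j) as [L|[->|L]]; auto.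
           ++ destruct (lt_ex _ _ L) as [d E].
              (* Coprimality needs the difference [d + 1] of the indices to divide [m], and it does
                 because [d < k]. *)
              destruct (Hd d) as [q ->].
              { apply lt_trans with j; auto. rewrite E.
                replace (i + (d + 1)) with (d + i + 1) by ring. apply le_lt_succ. }
              apply divides_coprime in H; auto. apply Hn in H; tauto.
           ++ destruct (lt_ex _ _ L) as [d E].
              destruct (Hd d) as [q ->].
              { apply lt_trans with i; auto. rewrite E.
                replace (j + (d + 1)) with (d + j + 1) by ring. apply le_lt_succ. }
              apply divides_coprime in H; auto. apply Hn in H; tauto.
        -- intros [[L| ->] K].
           ++ apply divides_mul_r, Hn; auto.
           ++ exists n. ring.
      * exists n. intros i Hi. rewrite Hn, ltS; auto.
        split; [tauto|]. intros [[L| ->] K]; tauto.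
    + exists n. intros i Hi. rewrite Hn, ltS; auto.
      split; [tauto|]. intros [[L| ->] K]; tauto.
  - exists n. intros i Hi. rewrite Hn; tauto.
Qed.

Lemma singleton_code x : exists c, is_code c /\ forall i, fmember i c <-> i = x.
Proof.
  destruct (Delta0_comprehension (fun i => i = x)) as [S HS]; [dsolve|].
  destruct (bounded_set_code S (x + 1)) as (m & n & H).
  destruct (code_of_triple (triple (x + 1) m n)) as (c & Hc & Hi).
  { now exists (x + 1), m, n. }
  exists c. split; auto. intros i. rewrite Hi, fmember_triple.
  split.
  - intros [K L]. apply HS, H; auto.
  - intros ->. split; [apply lt_succ|]. apply H; [apply lt_succ|]. now apply HS.
Qed.

(** * Comprehension from bases *)

(** In the matroid built below any element of the larger set serves for the exchange, so an image of
    index 0 is enough. *)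
Lemma card_lt_inhabited c d : card_lt c d -> exists y, fmember y d.
Proof.
  intros (k & l & _ & (f & _ & Hf & Hex & _) & Hkl).
  assert (Hl : 0 < l).
  { destruct (pos l) as [->|H]; auto. now apply lt0 in Hkl. }
  destruct (Hex 0 Hl) as (x & Hx & _).
  destruct (Hf _ Hx) as (i & y & _ & _ & Hy). eauto.
Qed.

Lemma Sigma1_comprehension (R : num A -> num A -> Prop) :
  every_ematroid_has_basis A ->
  def bounded (fun v => R (v 0%nat) (v 1%nat)) ->
  exists X : set A, forall n, n ∈ X <-> exists m, R n m.
Proof.
  intros HB HR.
  (* The default dependent set needs an element of the Sigma^0_1 set; if there is none, the set to
     be formed is empty. *)
  destruct (classic (exists x z, R x z)) as [(x0 & z0 & H0)|Hempty].
  2: { destruct (Delta0_comprehension (fun n => n <> n)) as [X HX]; [dsolve|].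
       exists X. intros n. rewrite HX. split; [tauto|].
       intros [m Hm]. destruct Hempty. eauto. }
  destruct (singleton_code x0) as (Y0 & HY0 & HY0').
  (* [y] is a search stage: only witnesses below [y] are tried, which keeps [hit] bounded. *)
  set (hit := fun y c =>
    exists x, x < c + 1 /\ fmember x c /\ exists z, z < y /\ R x z).
  assert (Hhit : def bounded (fun v => hit (v 0%nat) (v 1%nat))).
  { unfold hit. dsolve. }
  (* The graph of the enumeration: [pair y c] lists [c] if stage [y] confirms it, and every other
     number lists [Y0]. *)
  set (G := fun n c =>
    (exists y, y < n + 1 /\ n = pair y c /\ is_code c /\ hit y c) \/
    (~ (exists y, y < n + 1 /\ exists Y, Y < n + 1 /\
          n = pair y Y /\ is_code Y /\ hit y Y)) /\ c = Y0).
  assert (HG : def bounded (fun v => G (v 0%nat) (v 1%nat))).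
  { unfold G. dsolve. }
  destruct (Delta0_comprehension (fun p =>
    exists n, n < p + 1 /\ exists c, c < p + 1 /\ p = pair n c /\ G n c))
    as [E HE]; [dsolve|].
  destruct (Delta0_comprehension (fun n => n = n)) as [M HM]; [dsolve|].
  assert (HE' : forall n c, pair n c ∈ E <-> G n c).
  { intros n c. rewrite HE. split.
    - intros (n' & _ & c' & _ & K & H). apply pair_inj in K.
      destruct K as [-> ->]. exact H.
    - intros H. exists n. split; [apply pair_l|]. exists c.
      split; [apply pair_r|]. auto. }
  assert (G1 : forall n c, pair n c ∈ E ->
    is_code c /\ exists x, fmember x c /\ exists z, R x z).
  { intros n c H. apply HE' in H. destruct H as [(y & _ & _ & Hc & Hh)|[_ ->]].
    - split; auto. destruct Hh as (x & _ & Hx & z & _ & Hz). eauto.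
    - split; auto. exists x0. split; [now apply HY0' | eauto]. }
  (* The stage is [z + 1], because a witness must lie strictly below its stage. *)
  assert (G2 : forall c x z, is_code c -> fmember x c -> R x z ->
    exists n, pair n c ∈ E).
  { intros c x z Hc Hx Hz. exists (pair (z + 1) c). apply HE'. left.
    exists (z + 1). split; [apply pair_l|]. do 2 (split; auto).
    exists x. split; [now apply fmember_lt|]. split; auto.
    exists z. auto using lt_succ. }
  destruct (HB M E) as (B & _ & Hind & Hsp).
  { split.
    - split.
      + intros p Hp. apply HE in Hp. destruct Hp as (n & _ & c & _ & -> & H).
        exists n, c. split; auto. split.
        * apply HE' in H. apply (G1 _ _ H).
        * intros x _. now apply HM.
      + intros n.
        destruct (classic (exists y, y < n + 1 /\ exists Y, Y < n + 1 /\
          n = pair y Y /\ is_code Y /\ hit y Y))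
          as [(y & Hy & Y & HY & K)|K].
        * exists Y. split.
          -- apply HE'. left. eauto.
          -- intros c H. apply HE' in H.
             destruct H as [(y' & _ & K' & _)|[K' _]].
             ++ destruct K as [K _]. rewrite K' in K. now apply pair_inj in K.
             ++ destruct K'. exists y. split; auto. exists Y. auto.
        * exists Y0. split.
          -- apply HE'. right. auto.
          -- intros c H. apply HE' in H.
             destruct H as [(y' & L & K' & K'')|[_ ->]]; auto.
             destruct K. exists y'. split; auto. exists c.
             split; [|auto]. rewrite K'. apply pair_r.
    - intros n c H. destruct (G1 _ _ H) as (_ & x & Hx & _). eauto.
    - intros n c Y H [HY _] Hsub. destruct (G1 _ _ H) as (_ & x & Hx & z & Hz).
      destruct (G2 Y x z) as [m Hm]; auto.
      exists m, Y. split; auto. reflexivity.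
    - intros X Y [HX _] [HY _] Hlt HXi HYi.
      destruct (card_lt_inhabited _ _ Hlt) as [y Hy].
      exists y. split; auto. intros (n & c & H & Hc).
      destruct (G1 _ _ H) as (_ & x & Hx & z & Hz).
      (* The loop [x] lies in [X] or is [y] itself, so [X] or [Y] would already be dependent. *)
      apply Hc in Hx. destruct Hx as [Hx| ->].
      + destruct (G2 X x z) as [m Hm]; auto.
        apply HXi. exists m, X. split; auto. reflexivity.
      + destruct (G2 Y y z) as [m Hm]; auto.
        apply HYi. exists m, Y. split; auto. reflexivity. }
  destruct (Delta0_comprehension (fun n => n ∉ B)) as [X HX]; [dsolve|].
  exists X. intros n. rewrite HX. split.
  - intros Hn. destruct (Hsp n) as (k & c & H & Hc); auto.
    { now apply HM. }
    destruct (G1 _ _ H) as (_ & x & Hx & z & Hz).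
    (* The loop [x] cannot be in [B], as its singleton is dependent; so it is [n]. *)
    destruct (Hc x Hx) as [Hx'| ->]; [|eauto].
    exfalso. destruct (singleton_code x) as (Y & HY & HY').
    destruct (G2 Y x z) as [m Hm]; auto.
    { now apply HY'. }
    apply (Hind m Y Hm). intros y Hy. apply HY' in Hy. now subst.
  - intros [z Hz] Hn. destruct (singleton_code n) as (Y & HY & HY').
    destruct (G2 Y n z) as [m Hm]; auto.
    { now apply HY'. }
    apply (Hind m Y Hm). intros y Hy. apply HY' in Hy. now subst.
Qed.

(** * From Sigma^0_1 comprehension to arithmetical comprehension *)

Lemma ext_on_vars (P : (nat -> num A) -> Prop) (N : nat) :
  (forall v u, (forall i, i < N -> v i = u i)%nat -> P v -> P u) ->
  forall v u, (forall i, i < N -> v i = u i)%nat -> P v <-> P u.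
Proof.
  intros H v u E. split; apply H; auto. intros i Hi. symmetry. auto.
Qed.

(* Variables 1 and 2 are merged into one by the pairing function until only
   variables 0 and 1 matter. *)
Lemma def_bounded_ex (N : nat) :
  (forall R : num A -> num A -> Prop,
     def bounded (fun v => R (v 0%nat) (v 1%nat)) ->
     exists X : set A, forall n, n ∈ X <-> exists m, R n m) ->
  forall P : (nat -> num A) -> Prop, def bounded P ->
  (forall v u, (forall i, i < N + 2 -> v i = u i)%nat -> P v -> P u) ->
  def bounded (fun v => exists n, P (scons n v)).
Proof.
  intros HC. induction N as [|N IH]; intros P HP HN.
  (* Only two variables matter: the quantified statement is a Sigma^0_1 property of one number,
     hence membership in a set given by [HC]. *)
  - destruct (HC (fun x n => P (fun i => match i with O => n | _ => x end)))
      as [X HX].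
    { apply (def_ext (fun v => P (fun i => v (match i with O => 1%nat | _ => O end)))).
      - intros v. apply (ext_on_vars P 2 HN). now intros [|i].
      - apply (def_vars P _ HP). }
    apply (def_ext (fun v => v 0%nat ∈ X)); [|dsolve].
    intros v. rewrite HX.
    split; intros [n Hn]; exists n; revert Hn; apply HN;
      intros [|[|i]] Hi; simpl; auto; lia.
  (* Variable 1 of [P'] is unpaired into variables 1 and 2 of [P] and later variables move down by
     one, so one variable fewer matters. *)
  - set (P' := fun w : nat -> num A => exists a, a < w 1%nat + 1 /\
      exists b, b < w 1%nat + 1 /\ w 1%nat = pair a b /\
      P (fun i => match i with
           | O => w 0%nat | 1%nat => a | 2%nat => b | S i => w i end)).
    assert (HP' : def bounded (fun v => exists n, P' (scons n v))).
    { apply IH.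
      - unfold P'.
        apply (def_bex formula_class_bounded); [tsolve|].
        apply (def_bex formula_class_bounded); [tsolve|].
        apply (def_and formula_class_bounded); [dsolve|].
        apply (def_ext (fun v => P (fun i => v (match i with
           | O => 2%nat | 1%nat => 1%nat | 2%nat => O | S i => S (S i) end)))).
        + intros v. apply (ext_on_vars P _ HN). now intros [|[|[|i]]].
        + apply (def_vars P _ HP).
      - intros v u E (a & Ha & b & Hb & Hab & H).
        rewrite (E 1%nat) in Ha, Hb, Hab by lia.
        exists a. split; auto. exists b. split; auto. split; auto.
        revert H. apply HN. intros [|[|[|i]]] Hi; auto; apply E; lia. }
    (* The packed variables, 1 and 2 under the quantifier, are 0 and 1 outside it; the bounded [c]
       names their pair. *)
    apply (def_ext (fun v => exists c, c < pair (v 0%nat) (v 1%nat) + 1 /\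
      c = pair (v 0%nat) (v 1%nat) /\
      exists n, P' (scons n (fun i => match i with O => c | S i => v (S (S i)) end)))).
    + intros v. split.
      * intros [n Hn]. exists (pair (v 0%nat) (v 1%nat)).
        split; [apply lt_succ|]. split; auto. exists n.
        exists (v 0%nat). split; [apply pair_l|]. exists (v 1%nat).
        split; [apply pair_r|]. split; [reflexivity|].
        revert Hn. apply HN. now intros [|[|[|i]]] Hi.
      * intros (c & _ & -> & n & a & _ & b & _ & E & H). exists n.
        apply pair_inj in E. destruct E as [<- <-].
        revert H. apply HN. now intros [|[|[|i]]] Hi.
    + apply (def_bex formula_class_bounded); [tsolve|].
      apply (def_and formula_class_bounded); [dsolve|].
      apply (def_ext (fun v => exists n, P' (scons n (fun i => v (match i with
           | O => O | S i => S (S (S i)) end))))).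
      * intros v. split; intros [n Hn]; exists n; revert Hn; unfold P'; simpl;
          intros (a & Ha & b & Hb & Hab & H); exists a; split; auto; exists b;
          split; auto; split; auto; revert H; apply HN;
          intros [|[|[|i]]] Hi; reflexivity.
      * exact (def_vars (fun v => exists n, P' (scons n v))
          (fun i => match i with O => O | S i => S (S (S i)) end) HP').
Qed.

(** Each quantifier is absorbed into a set parameter. For fixed sets, every arithmetical formula
    thus defines a bounded definable predicate, to which [Delta0_comprehension] applies. *)
Lemma arithmetical_comprehension_of_Sigma1 :
  (forall R : num A -> num A -> Prop,
     def bounded (fun v => R (v 0%nat) (v 1%nat)) ->
     exists X : set A, forall n, n ∈ X <-> exists m, R n m) ->
  arithmetical_comprehension A.
Proof.
  intros HC.
  assert (Hex : forall p V, def bounded (fun v : nat -> num A => sat v V p) ->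
    def bounded (fun v : nat -> num A => exists n, sat (scons n v) V p)).
  { intros p V H.
    apply (def_bounded_ex (vbound p) HC (fun v => sat v V p) H).
    intros v u E. apply (proj1 (sat_vbound p v u V ltac:(intros i Hi; apply E; lia))). }
  assert (K : forall p, arithmetical p ->
    forall V, def bounded (fun v : nat -> num A => sat v V p)).
  { induction p; simpl; intros Hp V.
    - apply (def_eq formula_class_bounded); [exists s | exists t]; now exists inl.
    - apply (def_lt formula_class_bounded); [exists s | exists t]; now exists inl.
    - apply (def_mem formula_class_bounded). exists t. now exists inl.
    - apply (def_not formula_class_bounded). auto.
    - apply (def_and formula_class_bounded); [apply IHp1 | apply IHp2]; tauto.
    - apply (def_or formula_class_bounded); [apply IHp1 | apply IHp2]; tauto.
    - apply (def_imp formula_class_bounded); [apply IHp1 | apply IHp2]; tauto.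
    - apply (def_iff formula_class_bounded); [apply IHp1 | apply IHp2]; tauto.
    - apply (def_ext (fun v => ~ exists n, sat (scons n v) V (fnot p))).
      + intros v. simpl. split; [intros H [n Hn]; auto|].
        intros H n. apply NNPP. eauto.
      + apply (def_not formula_class_bounded), Hex. simpl.
        apply (def_not formula_class_bounded). auto.
    - apply Hex. auto.
    - destruct Hp.
    - destruct Hp. }
  intros p Hp v V. apply Delta0_comprehension.
  destruct (K p Hp V) as (q & e & U & hq & H).
  (* All variables except 0 are frozen to their values under [v]. *)
  exists q, (fun i => match e i with
    | inl O => inl O | inl (S j) => inr (v j) | inr a => inr a end), U.
  split; auto. intros u. rewrite H. apply sat_vbound. intros i _.
  unfold lookup. destruct (e i) as [[|j]|a]; reflexivity.
Qed.

(** * The greedy basis *)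

Lemma arithmetical_def_comprehension (hC : arithmetical_comprehension A)
    (P : num A -> Prop) :
  def arithmetical (fun v => P (v 0%nat)) -> exists X : set A, forall n, n ∈ X <-> P n.
Proof.
  intros (p & e & V & hp & H).
  set (r := fun i : nat => match e i with inl O => O | _ => S i end).
  set (u := fun i : nat => match e i with inl _ => @zero A | inr a => a end).
  destruct (hC (rename r (fun i : nat => i) p) (arithmetical_rename p hp _ _) u V)
    as [X HX].
  exists X. intros n. rewrite HX, (H (scons n (fun _ => 0))).
  apply sat_rename; [|reflexivity]. intros i. unfold lookup, r.
  destruct (e i) as [[|j]|a] eqn:Ei; simpl; auto; unfold u; now rewrite Ei.
Qed.

(** The least strict upper bound [b] is a successor, and its predecessor is an element, as otherwise
    it would be a smaller bound. *)
Lemma fmember_max c : (exists x, fmember x c) ->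
  exists y, fmember y c /\ forall z, fmember z c -> z = y \/ z < y.
Proof.
  intros [x Hx].
  destruct (least_number (fun b => forall z, z < c + 1 -> fmember z c -> z < b))
    as (b & Hb & Hl); [dsolve | exists (c + 1); auto |].
  destruct (zero_or_succ b) as [->|[y ->]].
  { destruct (lt0 x). apply Hb; auto using fmember_lt. }
  assert (K : forall z, fmember z c -> z = y \/ z < y).
  { intros z Hz. destruct (proj1 (ltS z y)); auto.
    apply Hb; auto using fmember_lt. }
  exists y. split; auto. apply NNPP. intros Hy.
  apply (Hl y (lt_succ y)). intros z _ Hz.
  destruct (K z Hz) as [->|]; [contradiction|auto].
Qed.

Section Greedy.

Context (M E : set A) (hC : arithmetical_comprehension A).

(** The reason to reject [y]: together with the numbers below it chosen by [(m, n)] it would include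
    a dependent set. *)
Definition blocked y m n : Prop :=
  exists k c, pair k c ∈ E /\
    forall z, fmember z c -> z = y \/ z < y /\ divides (m * (z + 1) + 1) n.

(* [(m, n)] codes the choices that the greedy algorithm makes below [x]. *)
Definition history x m n : Prop :=
  forall y, y < x ->
    (divides (m * (y + 1) + 1) n <-> y ∈ M /\ ~ blocked y m n).

Lemma blocked_ext y m n m' n' :
  (forall z, z < y ->
    (divides (m * (z + 1) + 1) n <-> divides (m' * (z + 1) + 1) n')) ->
  blocked y m n -> blocked y m' n'.
Proof.
  intros H (k & c & Hc & K). exists k, c. split; auto. intros z Hz.
  destruct (K z Hz) as [?|[L D]]; auto. right. split; auto. now apply H.
Qed.

(** The choice at [y] depends only on those below [y]. Although [blocked] has unbounded quantifiers,
    the statement proved by induction mentions only divisibilities and is bounded. *)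
Lemma history_unique x x' m n m' n' y :
  history x m n -> history x' m' n' -> y < x -> y < x' ->
  (divides (m * (y + 1) + 1) n <-> divides (m' * (y + 1) + 1) n').
Proof.
  intros H H'.
  refine (strong_ind (fun y => y < x -> y < x' ->
    (divides (m * (y + 1) + 1) n <-> divides (m' * (y + 1) + 1) n')) _ _ y).
  - dsolve.
  - clear y. intros y IH L L'. rewrite (H y L), (H' y L').
    assert (K : forall z, z < y ->
      (divides (m * (z + 1) + 1) n <-> divides (m' * (z + 1) + 1) n')).
    { intros z Hz. apply IH; eauto using lt_trans. }
    split; intros [HM HN]; (split; [exact HM|]); intros D; apply HN; revert D;
      apply blocked_ext; auto.
    intros z Hz. symmetry. auto.
Qed.

Lemma history_exists x : exists m n, history x m n.
Proof.
  (* The arithmetical statement becomes membership in [X], so induction for bounded formulas applies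
     to it. *)
  destruct (arithmetical_def_comprehension hC (fun x => exists m n, history x m n))
    as [X HX]; [unfold history, blocked; dsolve|].
  apply HX. revert x.
  refine (Delta0_ind (fun x => x ∈ X) _ _ _); [dsolve | |].
  - apply HX. exists 0, 0. intros y Hy. now apply lt0 in Hy.
  - intros x Hx. apply HX. apply HX in Hx. destruct Hx as (m & n & H).
    (* [S] extends the old choices by the decision at [x]; it is coded afresh, since a longer
       segment may need a new [m']. *)
    destruct (arithmetical_def_comprehension hC (fun y =>
      y < x /\ divides (m * (y + 1) + 1) n \/
      y = x /\ y ∈ M /\ ~ blocked y m n))
      as [S HS]; [unfold blocked; dsolve|].
    destruct (bounded_set_code S (x + 1)) as (m' & n' & H').
    exists m', n'.
    assert (K : forall z, z < x ->
      (divides (m * (z + 1) + 1) n <-> divides (m' * (z + 1) + 1) n')).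
    { intros z Hz. rewrite H', HS; [|apply ltS; auto].
      split; [auto|]. intros [[_ ?]|[-> _]]; auto. now apply lt_irrefl in Hz. }
    intros y Hy.
    assert (Kb : blocked y m n <-> blocked y m' n').
    { split; apply blocked_ext; intros z Hz; [|symmetry]; apply K;
        apply ltS in Hy; destruct Hy as [Hy| ->]; eauto using lt_trans. }
    rewrite <- Kb. rewrite (H' y Hy), HS. apply ltS in Hy.
    destruct Hy as [Hy| ->].
    + rewrite (H y Hy). split; [|auto].
      intros [[_ ?]|[-> _]]; auto. now apply lt_irrefl in Hy.
    + split; [|auto]. intros [[L _]|[_ ?]]; auto. now apply lt_irrefl in L.
Qed.

Lemma greedy_set : exists B : set A, forall x, x ∈ B <-> x ∈ M /\
  ~ exists k c, pair k c ∈ E /\ forall z, fmember z c -> z = x \/ z < x /\ z ∈ B.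
Proof.
  destruct (arithmetical_def_comprehension hC (fun x =>
    exists m n, history (x + 1) m n /\ divides (m * (x + 1) + 1) n))
    as [B HB]; [unfold history, blocked; dsolve|].
  exists B. intros x. destruct (history_exists (x + 1)) as (m & n & H).
  (* By uniqueness all histories agree, so this single one describes [B] up to and including [x]. *)
  assert (K : forall z, z < x + 1 -> (z ∈ B <-> divides (m * (z + 1) + 1) n)).
  { intros z Hz. rewrite HB. split.
    - intros (m' & n' & H' & D). revert D.
      exact (proj1 (history_unique _ _ _ _ _ _ _ H' H (lt_succ z) Hz)).
    - intros D. destruct (history_exists (z + 1)) as (m' & n' & H').
      exists m', n'. split; auto. revert D.
      exact (proj2 (history_unique _ _ _ _ _ _ _ H' H (lt_succ z) Hz)). }
  rewrite (K x (lt_succ x)), (H x (lt_succ x)).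
  assert (Kb : blocked x m n <-> exists k c, pair k c ∈ E /\
    forall z, fmember z c -> z = x \/ z < x /\ z ∈ B).
  { unfold blocked. split; intros (k & c & Hc & L); exists k, c; split; auto;
      intros z Hz; (destruct (L z Hz) as [?|[L1 L2]]; [auto|]);
      right; (split; [exact L1|]); apply K; auto; apply ltS; auto. }
  now rewrite Kb.
Qed.

End Greedy.

Lemma basis_exists (hC : arithmetical_comprehension A) : every_ematroid_has_basis A.
Proof.
  intros M E HE. destruct (greedy_set M E hC) as [B HB]. exists B.
  split; [|split].
  - intros x Hx. now apply HB in Hx.
  - intros n c Hc Hsub.
    (* The greatest element of a dependent subset of [B] would have been rejected at its turn; it
       exists because dependent sets are nonempty. *)
    destruct (fmember_max c (em_nonempty M E HE n c Hc)) as (y & Hy & Hmax).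
    destruct (proj1 (HB y) (Hsub y Hy)) as [_ K]. apply K.
    exists n, c. split; auto. intros z Hz.
    destruct (Hmax z Hz); auto.
  - intros x HxM HxB. apply NNPP. intros K. apply HxB, HB. split; auto.
    intros (n & c & Hc & L). apply K. exists n, c. split; auto.
    intros z Hz. destruct (L z Hz) as [?|[_ ?]]; auto.
Qed.

Lemma ACA0_of_bases : every_ematroid_has_basis A -> ACA0 A.
Proof.
  intros HB. split.
  - exact (RCA0_basic A hA).
  - intros X H0 HS n. refine (Delta0_ind (fun n => n ∈ X) _ H0 HS n). dsolve.
  - apply arithmetical_comprehension_of_Sigma1.
    intros R HR. now apply Sigma1_comprehension.
Qed.

End Arithmetic.

Theorem theorem1p3 (A : L2_structure) (hA : RCA0 A) :
  ACA0 A <-> every_ematroid_has_basis A.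
Proof.
  split.
  - intros H. exact (basis_exists hA (ACA0_comprehension A H)).
  - exact (ACA0_of_bases hA).
Qed.
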